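(* Let $R=\mathbb{C}[x_1,\ldots,x_n]$ be the polynomial ring in $n\geqslant 4$ variables, let $\mathfrak{m}=(x_1,\ldots,x_n)$, and let $2\leqslant s\leqslant n-2$ be an integer. Consider $$I^{(1)}=(x_1,\ldots,x_s)^2+(x_{s+1},\ldots,x_n)\quad\text{and}\quad I^{(2)}=(H_2)+\mathfrak{m}^3,$$ where $H_2\subset R_2$ is a generic linear subspace of codimension $2$ of the space $R_2$ of quadratic forms. Then the point $[I^{(1)}\supset I^{(2)}]\in\mathrm{Hilb}^{(1+s,\,n+3)}\mathbb{A}^n$ is non-smoothable.
   Context: All schemes are over $\mathbb{C}$. For a non-decreasing sequence $\underline{d}=(d_1,\ldots,d_r)$ of positive integers, $\mathrm{Hilb}^{\underline{d}}\mathbb{A}^n$ denotes the nested Hilbert scheme of points, representing the functor sending a $\mathbb{C}$-scheme $B$ to the set of nestings $\mathscr{Z}^{(1)}\subset\cdots\subset\mathscr{Z}^{(r)}\subset\mathbb{A}^n\times B$ of closed, $B$-flat, $B$-finite subschemes with $\mathscr{Z}^{(i)}$ of length $d_i$ over $B$. Its closed points are denoted $[Z^{(1)}\subset\cdots\subset Z^{(r)}]$ or $[I^{(1)}\supset\cdots\supset I^{(r)}]$, where $I^{(i)}\subset R$ is the ideal of $Z^{(i)}$ and $\dim_{\mathbb{C}}R/I^{(i)}=d_i$. The smoothable component $\mathrm{Hilb}^{\underline{d}}_{\mathrm{sm}}\mathbb{A}^n$ is the closure in $\mathrm{Hilb}^{\underline{d}}\mathbb{A}^n$ of the locus of nestings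 $[Z^{(1)}\subset\cdots\subset Z^{(r)}]$ with $Z^{(r)}$ reduced; it is an irreducible component of dimension $d_r\cdot n$. A nesting is smoothable if the corresponding point lies in this component, and non-smoothable otherwise. ''Generic'' means for $H_2$ in a non-empty Zariski open subset of the Grassmannian of codimension $2$ subspaces of $R_2$. *)

(* Defs.v *)
From HB Require Import structures.
From mathcomp Require Import all_boot all_order all_algebra.
From mathcomp Require Import boolp classical_sets reals complex.
From mathcomp Require Import mpoly.

Set Implicit Arguments.
Unset Strict Implicit.
Unset Printing Implicit Defensive.

Import GRing.Theory.
Local Open Scope ring_scope.
Local Open Scope classical_set_scope.

Section Ideals.
Variable T : comNzRingType.
Implicit Types I J : set T.

Definition is_ideal I : Prop :=
  [/\ I 0, forall p q, I p -> I q -> I (p + q) & forall a p, I p -> I (a * p)].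

Definition ideal_gen (G : set T) : set T := smallest is_ideal G.

Definition ideal_add I J : set T := [set p + q | p in I & q in J].

Definition ideal_mul I J : set T := ideal_gen [set p * q | p in I & q in J].

Definition ideal_pow I (k : nat) : set T := iter k (ideal_mul I) setT.

Definition is_radical I : Prop := forall p k, I (p ^+ k) -> I p.

End Ideals.

Section Families.
Variables (n : nat) (A : comNzRingType).
Implicit Type J : set {mpoly A[n]}.

(* The localization (A[x]/J)_f is a free A_f-module of rank d. Localizations
   are unfolded, and the basis elements are taken in A[x]/J, which is no
   restriction since f is invertible in A_f. *)
Definition quot_free_at (f : A) J (d : nat) : Prop :=
  exists b : 'I_d -> {mpoly A[n]},
    (forall p, exists (N : nat) (c : 'I_d -> A),
       J (f ^+ N *: p - \sum_(j < d) c j *: b j)) /\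
    (forall c : 'I_d -> A, J (\sum_(j < d) c j *: b j) ->
       exists N : nat, forall j, f ^+ N * c j = 0).

(* V(J) is finite and flat of length d over Spec A, i.e. A[x]/J is a locally
   free A-module of rank d: Spec A is covered by the basic open sets D(f i). *)
Definition finite_flat_of_length J (d : nat) : Prop :=
  exists (k : nat) (f g : 'I_k -> A),
    \sum_(i < k) g i * f i = 1 /\ forall i, quot_free_at (f i) J d.

Definition nested r (I : r.-tuple (set {mpoly A[n]})) : Prop :=
  forall i j : 'I_r, (i <= j)%N -> tnth I j `<=` tnth I i.

(* The value on Spec A of the nested Hilbert functor. *)
Definition hilb_family r (d : r.-tuple nat) (J : r.-tuple (set {mpoly A[n]})) :
    Prop :=
  [/\ forall i, is_ideal (tnth J i), nested J &
      forall i, finite_flat_of_length (tnth J i) (tnth d i)].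

End Families.

Section NestedHilbertScheme.
Variables (K : closedFieldType) (n : nat).

(* dim_K K[x]/I = d *)
Definition quot_dim (I : set {mpoly K[n]}) (d : nat) : Prop :=
  exists b : 'I_d -> {mpoly K[n]},
    (forall p, exists c : 'I_d -> K, I (p - \sum_(j < d) c j *: b j)) /\
    (forall c : 'I_d -> K, I (\sum_(j < d) c j *: b j) -> forall j, c j = 0).

Definition hilb_point r (d : r.-tuple nat) (I : r.-tuple (set {mpoly K[n]})) :
    Prop :=
  [/\ forall i, is_ideal (tnth I i), nested I &
      forall i, quot_dim (tnth I i) (tnth d i)].

Definition is_Kpoint (A : comAlgType K) (phi : {rmorphism A -> K}) : Prop :=
  forall c : K, phi c%:A = c.

(* The fibre of a family over Spec A at a K-point phi of Spec A. *)
Definition fibre (A : comAlgType K) (phi : {rmorphism A -> K}) r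
    (J : r.-tuple (set {mpoly A[n]})) : r.-tuple (set {mpoly K[n]}) :=
  map_tuple (fun I => ideal_gen [set map_mpoly phi p | p in I]) J.

(* The Zariski topology on the closed points of the nested Hilbert scheme,
   read off the functor it represents: S is closed iff its preimage under the
   classifying morphism of every family over an affine K-scheme Spec A is
   Zariski closed in the set of K-points of Spec A. (For the "if" part, apply
   this to the universal family over an affine open cover.) Only the
   points of S satisfying [hilb_point d] matter. *)
Definition hilb_closed r (d : r.-tuple nat)
    (S : set (r.-tuple (set {mpoly K[n]}))) : Prop :=
  forall (A : comAlgType K) (J : r.-tuple (set {mpoly A[n]})),
    hilb_family d J ->
    exists E : set A, forall phi : {rmorphism A -> K}, is_Kpoint phi ->
      (S (fibre phi J) <-> forall a, E a -> phi a = 0).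

(* The smoothable component; [tnth I ord_max] is the ideal of the largest
   subscheme of the nesting. *)
Definition smoothable r (d : r.+1.-tuple nat)
    (I : r.+1.-tuple (set {mpoly K[n]})) : Prop :=
  hilb_point d I /\
  forall S, hilb_closed d S ->
    (forall I' : r.+1.-tuple (set {mpoly K[n]}),
       hilb_point d I' -> is_radical (tnth I' ord_max) -> S I') ->
    S I.

End NestedHilbertScheme.

Section Grassmannian.
Variables (K : fieldType) (V : vectType K).

Definition Gr (k : nat) : set {vspace V} := [set H | \dim H = k].

(* The coordinates of a k-tuple of vectors, flattened to one family. *)
Definition frame_coord k (X : k.-tuple V) : 'I_(k * \dim {:V}) -> K :=
  fun l => mxvec (\matrix_(i, j) coord (vbasis {:V}) j (tnth X i)) 0 l.

(* The Zariski topology of Gr k as the quotient of the variety of k-frames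
   (linearly independent k-tuples) by GL_k: U is open iff its preimage in the
   variety of frames is the complement of the zero locus of polynomials. *)
Definition Gr_open (k : nat) (U : set {vspace V}) : Prop :=
  U `<=` Gr k /\
  exists E : set {mpoly K[k * \dim {:V}]},
    forall X : k.-tuple V, free X ->
      (U <<X>>%VS <-> exists2 p, E p & p.@[frame_coord X] != 0).

End Grassmannian.

Section Ideals12.
Variables (K : fieldType) (n : nat).

Definition vars_ideal (P : set 'I_n) : set {mpoly K[n]} :=
  ideal_gen [set 'X_i | i in P].

(* The variables are indexed from 0, so that x_1, ..., x_s are the 'X_i with
   i < s. *)
Definition ideal1 (s : nat) : set {mpoly K[n]} :=
  ideal_add (ideal_pow (vars_ideal [set i : 'I_n | (i < s)%N]) 2)
            (vars_ideal [set i : 'I_n | (s <= i)%N]).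

Definition max_ideal : set {mpoly K[n]} := vars_ideal setT.

End Ideals12.

Arguments vars_ideal : clear implicits.
Arguments ideal1 : clear implicits.
Arguments max_ideal : clear implicits.

(* The number of variables is a successor because the library has the vector
   space structure on forms of degree 2 only in that case. *)
Definition ideal2 (K : fieldType) (m : nat)
    (H : {vspace dhomog m.+1 K 2}) : set {mpoly K[m.+1]} :=
  ideal_add
    (ideal_gen [set mpoly_of_dhomog q | q in [set q | q \in H]])
    (ideal_pow (max_ideal K m.+1) 3).

(* Main.v *)
Require Import Defs.
From HB Require Import structures.
From mathcomp Require Import all_boot all_order all_algebra.
From mathcomp Require Import boolp classical_sets reals complex.
From mathcomp Require Import zify ring mpoly.

Set Implicit Arguments.
Unset Strict Implicit.
Unset Printing Implicit Defensive.

Import GRing.Theory.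
Local Open Scope ring_scope.
Local Open Scope classical_set_scope.

(** Let c = n + 2 - s be the difference of the two lengths.  For a nesting
    I1 ⊃ I2 consider the colon ideal (I2 : I1), the annihilator of I1/I2 in
    the polynomial ring.  The argument is that the condition
    colength (I2 : I1) <= c separates the point from the smoothable component.

    - The condition is closed ([colon_colength_closed]).  Its failure says that
      multiplication maps I1/I2 -> K[x]/I2 by some c + 1 polynomials are
      linearly independent.  Finitely many elements of I1 and finitely many
      coordinates of K[x]/I2 suffice to see this ([separating_rows]); in a
      family the coordinates are regular functions on the base, and a
      determinant that is nonzero at one point is nonzero around it.

    - It holds when I2 is radical ([radical_colon_colength]).  Then K[x]/I2 is
      a finite product of fields, the ideal I1/I2 is generated by an idempotent
      e, and a polynomial p kills I1/I2 as soon as p e = 0 in I1/I2, which is a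
      space of dimension c.  By closedness the condition holds on the whole
      smoothable component.

    - It fails for a generic H ([avoiding_not_colon_colength]).  No
      polynomial with a nonzero constant term is in (I2 : I1), because I1
      contains all quadrics and H does not; and a linear form l is in
      (I2 : I1) only if l x_j is in H for all j > s.  These are 2 (n - s)
      linear conditions on l.  Since 2 (n - s) >= n - s + 2 they can be
      independent on the span of x_1, x_2, x_(s+1), ..., x_n, and then the
      colength of (I2 : I1) is at least 1 + (n - s + 2) = c + 1.

    That the conditions are independent is open in H: it is expressed by
    maximal minors of a frame of H bordered with the quadrics l x_j
    ([Gr_open_avoiding]).  It is satisfied by the common kernel of the two
    functionals q |-> sum over j > s of the coefficient of x_j^2, and
    q |-> coefficient of x_1 x_(n-1) plus coefficient of x_2 x_n
    ([special_avoids]). *)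

(** * Finite separating families of functionals *)

Section Separation.
Variable K : fieldType.

Lemma row_free_col_mx (r n : nat) (B : 'M[K]_(r, n)) (y : 'rV_n) :
  row_free B -> ~~ (y <= B)%MS -> row_free (col_mx B y).
Proof.
move=> freeB yB; rewrite /row_free eqn_leq rank_leq_row /=.
suff: (\rank B < \rank (col_mx B y))%N.
  by rewrite (eqP freeB) -[X in (X <= _)%N]addn1.
apply: rank_ltmx; rewrite ltmxE -!addsmxE addsmxSl /=.
by apply: contra yB; apply: submx_trans; rewrite addsmxSr.
Qed.

(** If only the zero vector is annihilated by all functionals in V, then k
    members of V already form an invertible matrix.  This turns a condition
    on infinitely many functionals into the nonvanishing of one determinant. *)
Lemma separating_rows (k : nat) (V : set 'rV[K]_k) :
  (forall a : 'cV[K]_k, a != 0 -> exists2 v, V v & v *m a != 0) ->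
  exists w : 'I_k -> 'rV[K]_k,
    (forall j, V (w j)) /\ \matrix_j w j \in unitmx.
Proof.
move=> sepV.
suff [B VB freeB] : exists2 B : 'M[K]_k, (forall j, V (row j B)) & row_free B.
  exists (fun j => row j B); split=> //.
  by rewrite (_ : (\matrix_j _) = B) -?row_free_unit //; apply/row_matrixP=> j;
     rewrite rowK.
suff build r : (r <= k)%N ->
    exists2 B : 'M[K]_(r, k), (forall j, V (row j B)) & row_free B.
  exact: build.
(* As long as r < k, some nonzero a is annihilated by the rows found so far;
   a member of V that does not annihilate a is independent of them. *)
elim: r => [|r IHr] ltrk.
  exists 0; first by case.
  by rewrite /row_free mxrank0.
have [B VB freeB] := IHr (ltnW ltrk).
have [a aN0 Ba0] : exists2 a : 'cV[K]_k, a != 0 & B *m a = 0.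
  have : kermx B^T != 0.
    by rewrite kermx_eq0 /row_free mxrank_tr (eqP freeB) ltn_eqF.
  move=> /rowV0Pn [u /sub_kermxP uB uN0]; exists u^T; first by rewrite trmx_eq0.
  by apply: trmx_inj; rewrite trmx_mul trmxK uB trmx0.
have [v Vv va] := sepV a aN0.
rewrite -addn1; exists (col_mx B v).
  move=> j; case: (splitP j) => i ji.
    by have -> : j = lshift 1 i by [apply: val_inj]; rewrite rowKu.
  by have -> : j = rshift r i by [apply: val_inj]; rewrite rowKd row_id.
apply: row_free_col_mx => //; apply: contra va => /submxP [D ->].
by rewrite -mulmxA Ba0 mulmx0.
Qed.

End Separation.

(** * Ideals of finite colength *)

Section IdealClosure.
Variables (T : comNzRingType) (I : set T).
Hypothesis idealI : is_ideal I.

Lemma ideal0 : I 0. Proof. by case: idealI. Qed.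

Lemma idealD p q : I p -> I q -> I (p + q).
Proof. by case: idealI => _ + _; apply. Qed.

Lemma idealMl a p : I p -> I (a * p). Proof. by case: idealI => _ _; apply. Qed.

Lemma idealMr p a : I p -> I (p * a).
Proof. by rewrite mulrC; apply: idealMl. Qed.

Lemma idealN p : I p -> I (- p).
Proof. by rewrite -mulN1r; apply: idealMl. Qed.

Lemma idealB p q : I p -> I q -> I (p - q).
Proof. by move=> Ip Iq; apply: idealD => //; apply: idealN. Qed.

Lemma ideal_sum (J : Type) (r : seq J) (P : pred J) (F : J -> T) :
  (forall j, P j -> I (F j)) -> I (\sum_(j <- r | P j) F j).
Proof. by move=> IF; apply: big_ind => //; [apply: ideal0 | apply: idealD]. Qed.

End IdealClosure.

Section IdealGen.
Variable T : comNzRingType.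
Implicit Types I J G : set T.

Lemma ideal_gen_ideal G : is_ideal (ideal_gen G).
Proof.
split=> [J [/ideal0 ? _] //|p q Ip Iq J [iJ GJ]|a p Ip J [iJ GJ]].
  by apply: idealD => //; [apply: Ip | apply: Iq].
by apply: idealMl => //; apply: Ip.
Qed.

Lemma ideal_gen_in G x : G x -> ideal_gen G x.
Proof. by move=> Gx J [_]; apply. Qed.

Lemma ideal_gen_min G I : is_ideal I -> G `<=` I -> ideal_gen G `<=` I.
Proof. by move=> iI GI x; apply. Qed.

Lemma ideal_mul_in I J p q : I p -> J q -> ideal_mul I J (p * q).
Proof. by move=> Ip Jq; apply: ideal_gen_in; exists p => //; exists q. Qed.

Lemma ideal_add_ideal I J :
  is_ideal I -> is_ideal J -> is_ideal (ideal_add I J).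
Proof.
move=> iI iJ; split.
- by exists 0; [exact: ideal0 | exists 0; [exact: ideal0 | rewrite addr0]].
- move=> _ _ [p Ip [q Jq <-]] [p' Ip' [q' Jq' <-]].
  exists (p + p'); first exact: idealD.
  by exists (q + q'); [exact: idealD | rewrite addrACA].
- move=> a _ [p Ip [q Jq <-]].
  exists (a * p); first exact: idealMl.
  by exists (a * q); [exact: idealMl | rewrite mulrDr].
Qed.

Lemma ideal_add_inl I J p : is_ideal J -> I p -> ideal_add I J p.
Proof.
by move=> iJ Ip; exists p => //; exists 0; [exact: ideal0 | rewrite addr0].
Qed.

Lemma ideal_add_inr I J q : is_ideal I -> J q -> ideal_add I J q.
Proof.
by move=> iI Jq; exists 0; [exact: ideal0 | exists q; rewrite ?add0r].
Qed.

Lemma ideal_add_min I J L :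
  is_ideal L -> I `<=` L -> J `<=` L -> ideal_add I J `<=` L.
Proof.
by move=> iL IL JL _ [p Ip [q Jq <-]]; apply: idealD; [|apply: IL|apply: JL].
Qed.

End IdealGen.

Lemma idealZ (A : comNzRingType) (n : nat) (I : set {mpoly A[n]}) a p :
  is_ideal I -> I p -> I (a *: p).
Proof. by move=> iI Ip; rewrite -mul_mpolyC; apply: idealMl. Qed.

Section QuotientDimension.
Variables (K : closedFieldType) (n : nat).
Implicit Type I : set {mpoly K[n]}.

Lemma quot_dim_linear I d : is_ideal I -> quot_dim I d ->
  exists L : {linear {mpoly K[n]} -> 'rV[K]_d},
    (forall p, I p <-> L p = 0) /\ (forall v, exists p, L p = v).
Proof.
move=> iI [b [bspan bfree]].
have /choice[c cP] : forall p, exists v : 'rV[K]_d,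
    I (p - \sum_(j < d) v 0 j *: b j).
  move=> p; have [c cP] := bspan p; exists (\row_j c j).
  by rewrite (eq_bigr (fun j => c j *: b j)) // => j _; rewrite mxE.
have coordE p (v : 'rV[K]_d) : I (p - \sum_(j < d) v 0 j *: b j) -> c p = v.
  move=> pv; apply/rowP=> j; apply/eqP; rewrite -subr_eq0; apply/eqP.
  apply: (bfree (fun j => c p 0 j - v 0 j)).
  rewrite (_ : \sum__ _ = (p - \sum_(j < d) v 0 j *: b j) -
                          (p - \sum_(j < d) c p 0 j *: b j)).
    exact: idealB.
  rewrite opprB addrC addrA subrK -sumrB.
  by apply: eq_bigr => k _; rewrite scalerBl.
have linc : linear c.
  move=> a p q; apply: coordE.
  rewrite (_ : _ - _ = a *: (p - \sum_(j < d) c p 0 j *: b j) +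
                       (q - \sum_(j < d) c q 0 j *: b j)).
    by apply: idealD => //; apply: idealZ.
  rewrite scalerBr scaler_sumr addrACA -opprD -big_split /=; congr (_ - _).
  by apply: eq_bigr => j _; rewrite !mxE scalerDl scalerA.
pose L : {linear {mpoly K[n]} -> 'rV[K]_d} :=
  HB.pack c (GRing.isLinear.Build K {mpoly K[n]} 'rV[K]_d _ c linc).
exists L; split=> [p|v].
  split=> [Ip | Lp].
    apply: coordE; rewrite big1 ?subr0 // => j _.
    by rewrite mxE scale0r.
  have := cP p; rewrite -[c p]/(L p) Lp big1 ?subr0 // => j _.
  by rewrite mxE scale0r.
exists (\sum_(j < d) v 0 j *: b j); apply: coordE.
by rewrite subrr; apply: ideal0.
Qed.

Lemma linear_quot_dim I d (L : {linear {mpoly K[n]} -> 'rV[K]_d}) :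
  (forall p, I p <-> L p = 0) -> (forall v, exists p, L p = v) -> quot_dim I d.
Proof.
move=> kerL surjL.
have /choice[b bP] : forall j : 'I_d, exists p, L p = delta_mx 0 j.
  by move=> j; apply: surjL.
have LE (c : 'I_d -> K) : L (\sum_(j < d) c j *: b j) = \row_j c j.
  rewrite linear_sum [RHS]row_sum_delta; apply: eq_bigr => j _.
  by rewrite linearZ /= bP mxE.
exists b; split=> [p | c /kerL].
  exists (fun j => L p 0 j); apply/kerL; rewrite linearB /= LE.
  by apply/eqP; rewrite subr_eq0; apply/eqP/rowP => j; rewrite mxE.
by rewrite LE => /rowP c0 j; have := c0 j; rewrite !mxE.
Qed.

(** The space I1/I2 has dimension d2 - d1: adding representatives of a basis of
    K[x]/I1 to the u i gives more than d2 elements of K[x]/I2, and in a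
    relation between them the coefficients of the representatives vanish
    modulo I1. *)
Lemma relation_modulo (I1 I2 : set {mpoly K[n]}) (d1 d2 k : nat)
    (u : 'I_k -> {mpoly K[n]}) :
  is_ideal I1 -> is_ideal I2 -> I2 `<=` I1 ->
  quot_dim I1 d1 -> quot_dim I2 d2 -> (forall i, I1 (u i)) -> (d2 < k + d1)%N ->
  exists2 a : 'cV[K]_k, a != 0 & I2 (\sum_i a i 0 *: u i).
Proof.
move=> iI1 iI2 I21 [b [_ bfree]] dimI2 I1u ltd.
have [L [kerL _]] := quot_dim_linear iI2 dimI2.
pose M := col_mx (\matrix_i L (u i)) (\matrix_j L (b j)).
have : kermx M != 0.
  rewrite kermx_eq0 /row_free neq_ltn.
  by rewrite (leq_ltn_trans (rank_leq_col M) ltd).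
move=> /rowV0Pn [w /sub_kermxP]; rewrite -[w]hsubmxK mul_row_col.
move: (lsubmx w) (rsubmx w) => a c wM wN0.
have rowE l (x : 'rV_l) (v : 'I_l -> {mpoly K[n]}) :
    x *m (\matrix_i L (v i)) = L (\sum_i x 0 i *: v i).
  rewrite mulmx_sum_row linear_sum; apply: eq_bigr => i _.
  by rewrite rowK linearZ.
move: wM; rewrite !rowE -linearD => /kerL I2ac.
have c0 : c = 0.
  apply/rowP=> j; rewrite [RHS]mxE; apply: (bfree (fun j => c 0 j)).
  rewrite -[X in I1 X](addKr (\sum_i a 0 i *: u i)).
  apply: idealD (I21 _ I2ac) => //; apply: idealN => //.
  by apply: ideal_sum => // i _; apply: idealZ.
exists a^T.
  apply: contra wN0; rewrite trmx_eq0 => /eqP ->.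
  by rewrite c0 row_mx0.
move: I2ac; rewrite c0 [X in _ + X]big1 ?addr0 => [|j _]; last first.
  by rewrite mxE scale0r.
by congr I2; apply: eq_bigr => i _; rewrite mxE.
Qed.

End QuotientDimension.

(** * The colength of the colon ideal *)

Section ColonColength.
Variables (K : fieldType) (n : nat).
Implicit Types I : set {mpoly K[n]}.

(** The colength of (I2 : I1) is at most c: any c + 1 polynomials are linearly
    dependent modulo (I2 : I1).  This form avoids bases and makes sense
    before the colength is known to be finite. *)
Definition colon_colength_le (c : nat) I1 I2 : Prop :=
  forall p : 'I_c.+1 -> {mpoly K[n]}, exists2 a : 'cV[K]_c.+1, a != 0 &
    forall q, I1 q -> I2 ((\sum_i a i 0 *: p i) * q).

Lemma not_colon_colength_le c I1 I2 : ~ colon_colength_le c I1 I2 ->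
  exists p : 'I_c.+1 -> {mpoly K[n]}, forall a : 'cV[K]_c.+1, a != 0 ->
    exists2 q, I1 q & ~ I2 ((\sum_i a i 0 *: p i) * q).
Proof.
move=> /existsNP [p pP]; exists p => a aN0; apply: contrapT => noq.
apply: pP; exists a => // q I1q; apply: contrapT => nI2.
by apply: noq; exists q.
Qed.

End ColonColength.

Section RadicalCase.
Variables (K : closedFieldType) (n : nat).
Implicit Types I : set {mpoly K[n]}.

(** A reduced Artinian ring is von Neumann regular.  The powers of x are
    linearly dependent modulo I, and dividing a relation by its lowest
    coefficient gives x ^ k (1 - x y) in I.  Hence x (1 - x y) is nilpotent
    modulo I. *)
Lemma radical_regular I d x : is_ideal I -> quot_dim I d -> is_radical I ->
  exists y, I (x - x ^+ 2 * y).
Proof.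
move=> iI dimI radI.
have dimT : @quot_dim K n setT 0.
  by exists (fun=> 0); split=> [p|c _ []//]; exists (fun=> 0).
have idealT : @is_ideal {mpoly K[n]} setT by [].
have [a aN0 Ia] : exists2 a : 'cV[K]_d.+1, a != 0 & I (\sum_i a i 0 *: x ^+ i).
  by apply: relation_modulo dimT dimI _ _ => //; rewrite addn0.
have /cV0Pn [i0 ai0] := aN0.
have [k ak kmin] := @arg_minnP _ i0 (fun i => a i 0 != 0) (fun i => i) ai0.
pose z := \sum_(i < d.+1 | i != k) a i 0 *: x ^+ (i - k.+1).
have sumE : \sum_i a i 0 *: x ^+ i = a k 0 *: x ^+ k + x ^+ k.+1 * z.
  rewrite (bigD1 k) //= mulr_sumr; congr (_ + _); apply: eq_bigr => i ik.
  rewrite -scalerAr -exprD.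
  have [ltik|leki] := ltnP i k.
    have [->|/kmin] := eqVneq (a i 0) 0; first by rewrite !scale0r.
    by rewrite leqNgt ltik.
  rewrite subnKC // ltn_neqAle leki andbT.
  by apply: contra ik => /eqP/val_inj ->.
pose y := - (a k 0)^-1 *: z.
have Iy : I (x ^+ k * (1 - x * y)).
  have -> : x ^+ k * (1 - x * y) =
      (a k 0)^-1 *: (a k 0 *: x ^+ k + x ^+ k.+1 * z).
    rewrite scalerDr scalerA mulVf // scale1r mulrBr mulr1 mulrA -exprSr.
    by rewrite /y -scalerAr scaleNr opprK.
  by apply: idealZ; rewrite // -sumE.
exists y; apply: (radI _ k.+1).
have -> : (x - x ^+ 2 * y) ^+ k.+1 =
          (x * (1 - x * y) ^+ k) * (x ^+ k * (1 - x * y)).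
  have -> : x - x ^+ 2 * y = x * (1 - x * y) by ring.
  by rewrite exprMn !exprS; ring.
exact: idealMl.
Qed.

(** For y as in [radical_regular], q y is an idempotent modulo I2 with
    (q y) q = q.  Idempotents e and e' combine to e + e' - e e', which fixes
    what either of them fixes. *)
Lemma radical_local_identity I1 I2 d (s : seq {mpoly K[n]}) :
  is_ideal I1 -> is_ideal I2 -> quot_dim I2 d -> is_radical I2 ->
  (forall q, q \in s -> I1 q) ->
  exists2 e, I1 e & forall q, q \in s -> I2 (q - e * q).
Proof.
move=> iI1 iI2 dimI2 radI2; elim: s => [|q s IHs] I1s.
  by exists 0; [exact: ideal0|].
have [r rs|e I1e eP] := IHs; first by apply: I1s; rewrite inE rs orbT.
have [y I2y] := radical_regular q iI2 dimI2 radI2.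
have I1q : I1 q by apply: I1s; rewrite inE eqxx.
exists (e + q * y - e * (q * y)).
  apply: idealB (idealMr _ _ _) => //.
  by apply: idealD => //; apply: idealMr.
move=> r; rewrite inE => /predU1P [->|rs].
  have -> : q - (e + q * y - e * (q * y)) * q = (1 - e) * (q - q ^+ 2 * y).
    by ring.
  exact: idealMl.
have -> : r - (e + q * y - e * (q * y)) * r = (1 - q * y) * (r - e * r).
  by ring.
by apply: idealMl => //; apply: eP.
Qed.

(** If c + 1 polynomials p i were independent modulo (I2 : I1), finitely many
    q j in I1 would show it.  Let e in I1 fix these q j modulo I2.  The p i e
    lie in I1/I2, of dimension at most c, so they have a relation; multiplying
    it by the q j gives a contradiction. *)
Lemma radical_colon_colength I1 I2 d1 d2 c :
  is_ideal I1 -> is_ideal I2 -> I2 `<=` I1 -> quot_dim I1 d1 ->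
  quot_dim I2 d2 -> (d2 <= c + d1)%N -> is_radical I2 ->
  colon_colength_le c I1 I2.
Proof.
move=> iI1 iI2 I21 dimI1 dimI2 led radI2; apply: contrapT.
move=> /not_colon_colength_le [p pP].
have [L [kerL _]] := quot_dim_linear iI2 dimI2.
pose V : set 'rV[K]_c.+1 :=
  [set v | exists2 q, I1 q & exists l, v = \row_i L (p i * q) 0 l].
have VE q l (a : 'cV[K]_c.+1) : ((\row_i L (p i * q) 0 l) *m a) 0 0 =
    L ((\sum_i a i 0 *: p i) * q) 0 l.
  rewrite mxE mulr_suml linear_sum summxE; apply: eq_bigr => i _.
  by rewrite -scalerAl linearZ !mxE mulrC.
have [|w [Vw unitw]] := @separating_rows K c.+1 V.
  move=> a /pP [q I1q /kerL/eqP/rV0Pn [l Ll]].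
  exists (\row_i L (p i * q) 0 l); first by exists q => //; exists l.
  by apply: contra Ll => /eqP va; rewrite -VE va mxE.
have /choice[q qP] : forall j, exists q, I1 q /\
    exists l, w j = \row_i L (p i * q) 0 l.
  by move=> j; have [q I1q ?] := Vw j; exists q.
have [|e I1e eP] :=
  @radical_local_identity I1 I2 d2 (codom q) iI1 iI2 dimI2 radI2.
  by move=> _ /codomP [j ->]; have [] := qP j.
have [a aN0 I2a] : exists2 a : 'cV[K]_c.+1, a != 0 &
    I2 (\sum_i a i 0 *: (p i * e)).
  apply: (relation_modulo iI1 iI2 I21 dimI1 dimI2) => [i|].
    exact: idealMl.
  by rewrite addSn ltnS.
case/negP: aN0; apply/eqP; rewrite -[a](mulKmx unitw).
suff -> : (\matrix_j w j) *m a = 0 by rewrite mulmx0.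
apply/row_matrixP=> j; rewrite row_mul rowK row0.
have [I1q [l ->]] := qP j.
apply/rowP=> i; rewrite (ord1 i) VE [RHS]mxE.
suff /kerL -> : I2 ((\sum_i a i 0 *: p i) * q j) by rewrite mxE.
have -> : (\sum_i a i 0 *: p i) * q j =
    (\sum_i a i 0 *: p i) * (q j - e * q j) +
    (\sum_i a i 0 *: (p i * e)) * q j.
  under [X in _ = _ + X * _]eq_bigr => k _ do rewrite scalerAl.
  by rewrite -mulr_suml; ring.
apply: idealD => //; first by apply: idealMl => //; apply: eP; apply: codom_f.
exact: idealMr.
Qed.

End RadicalCase.

(** * Fibres of a family in local coordinates *)

Section SpecialFibre.
Variables (K : fieldType) (n : nat) (A : comNzRingType).
Variable phi : {rmorphism A -> K}.
Hypothesis phi_surj : forall x : {mpoly K[n]}, exists p, map_mpoly phi p = x.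
Implicit Type J : set {mpoly A[n]}.

(** The image of an ideal under a surjective morphism is already an ideal, so
    elements of the fibre lift to J. *)
Lemma fibre_ideal_image J x : is_ideal J ->
  ideal_gen [set map_mpoly phi p | p in J] x <->
  exists2 p, J p & map_mpoly phi p = x.
Proof.
move=> iJ; split=> [|[p Jp <-]]; last by apply: ideal_gen_in; exists p.
suff iI : is_ideal [set map_mpoly phi p | p in J].
  by apply: (ideal_gen_min iI).
split.
- by exists 0; [exact: ideal0 | rewrite raddf0].
- move=> _ _ [p Jp <-] [q Jq <-]; exists (p + q); first exact: idealD.
  by rewrite raddfD.
- move=> a _ [p Jp <-]; have [b <-] := phi_surj a.
  by exists (b * p); [exact: idealMl | rewrite rmorphM].
Qed.

Section LocalBasis.
Variables (J : set {mpoly A[n]}) (f : A) (d : nat).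
Variable b : 'I_d -> {mpoly A[n]}.
Hypotheses (iJ : is_ideal J) (phif : phi f != 0).
Hypothesis bspan : forall p : {mpoly A[n]}, exists (N : nat) (c : 'I_d -> A),
  J (f ^+ N *: p - \sum_(j < d) c j *: b j).
Hypothesis bfree : forall c : 'I_d -> A, J (\sum_(j < d) c j *: b j) ->
  exists N : nat, forall j, f ^+ N * c j = 0.

(** The coefficients of t lie in the kernel of phi, so t is a combination of
    monomials with such coefficients, and so are the coordinates of t. *)
Lemma vanishing_coordinates (t : {mpoly A[n]}) : map_mpoly phi t = 0 ->
  exists (N : nat) (e : 'I_d -> A),
    (forall j, phi (e j) = 0) /\ J (f ^+ N *: t - \sum_(j < d) e j *: b j).
Proof.
move=> t0; rewrite [t]mpolyE.
apply: (big_ind (fun t : {mpoly A[n]} => exists (N : nat) (e : 'I_d -> A),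
    (forall j, phi (e j) = 0) /\ J (f ^+ N *: t - \sum_(j < d) e j *: b j))).
- exists 0%N, (fun=> 0); split=> [j|]; first exact: raddf0.
  rewrite scaler0 big1 ?subr0 => [|j _]; first exact: ideal0.
  by rewrite scale0r.
- move=> u v [N [e [e0 Je]]] [N' [e' [e'0 Je']]].
  exists (N + N')%N, (fun j => f ^+ N' * e j + f ^+ N * e' j).
  split=> [j|].
    by rewrite rmorphD !rmorphM /= e0 e'0 !mulr0 addr0.
  rewrite (_ : _ - _ = f ^+ N' *: (f ^+ N *: u - \sum_(j < d) e j *: b j) +
                       f ^+ N *: (f ^+ N' *: v - \sum_(j < d) e' j *: b j)).
    by apply: idealD => //; apply: idealZ.
  rewrite !scalerBr !scalerA -!exprD [(N' + N)%N]addnC !scaler_sumr addrACA.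
  rewrite -opprD -big_split scalerDr /=; congr (_ - _).
  by apply: eq_bigr => j _; rewrite scalerDl !scalerA.
- move=> m _; have [N [c Jc]] := bspan 'X_[m].
  exists N, (fun j => t@_m * c j); split=> [j|].
    by rewrite rmorphM -mcoeff_map_mpoly t0 mcoeff0 mul0r.
  rewrite (_ : _ - _ = t@_m *: (f ^+ N *: 'X_[m] - \sum_(j < d) c j *: b j)).
    exact: idealZ.
  rewrite scalerBr !scalerA mulrC scaler_sumr; congr (_ - _).
  by apply: eq_bigr => j _; rewrite scalerA.
Qed.

(** Base change of a local basis: b remains a basis of the quotient in the
    fibre, and the coordinates of the image of p are, up to the unit phi f ^ N,
    the values of the c j. *)
Lemma fibre_coordinates (p : {mpoly A[n]}) N (c : 'I_d -> A) :
  J (f ^+ N *: p - \sum_(j < d) c j *: b j) ->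
  ideal_gen [set map_mpoly phi q | q in J] (map_mpoly phi p) <->
  forall j, phi (c j) = 0.
Proof.
move=> Jc; rewrite fibre_ideal_image //; split=> [[r Jr rp] j|c0].
  have [|M [e [e0 Je]]] := @vanishing_coordinates (p - r).
    by rewrite rmorphB /= rp subrr.
  (* As r is in J, the coordinates f ^ M c_j - f ^ N e_j of f ^ (M + N) r are
     killed by a power of f. *)
  have [|N' /(_ j)] := @bfree (fun j => f ^+ M * c j - f ^+ N * e j).
    rewrite (_ : \sum__ _ =
        f ^+ N *: (f ^+ M *: (p - r) - \sum_(j < d) e j *: b j) -
        f ^+ M *: (f ^+ N *: p - \sum_(j < d) c j *: b j) +
        f ^+ N *: (f ^+ M *: r)).
      by apply: idealD; [|apply: idealB|]; rewrite //; do ?apply: idealZ.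
    rewrite !scalerBr !scalerA [f ^+ M * f ^+ N]mulrC !scaler_sumr.
    under eq_bigr => k _ do rewrite scalerBl -!scalerA.
    by rewrite sumrB; ring.
  move=> /(congr1 phi)/eqP; rewrite rmorph0 rmorphM rmorphB !rmorphM /= e0.
  rewrite mulr0 subr0 !rmorphXn !mulf_eq0 !expf_eq0 (negPf phif) !andbF /=.
  by move/eqP.
have [q Jq qE] : exists2 q, J q & map_mpoly phi q =
    map_mpoly phi (f ^+ N *: p - \sum_(j < d) c j *: b j).
  by exists (f ^+ N *: p - \sum_(j < d) c j *: b j).
have [g gE] := phi_surj (phi f ^- N)%:MP.
exists (g * q); first exact: idealMl.
rewrite rmorphM /= gE qE rmorphB /= map_mpolyZ rmorph_sum /=.
rewrite [X in _ - X]big1 => [|j _]; last by rewrite map_mpolyZ c0 scale0r.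
rewrite subr0 rmorphXn mul_mpolyC.
by apply: scalerK; rewrite expf_eq0 (negPf phif) andbF.
Qed.

(** With a common exponent N, linear relations between the p i can be read off
    their coordinates. *)
Lemma common_coordinates (k : nat) (p : 'I_k -> {mpoly A[n]}) :
  exists (N : nat) (c : 'I_k -> 'I_d -> A),
    forall i, J (f ^+ N *: p i - \sum_(j < d) c i j *: b j).
Proof.
have /choice[N /choice[c Jc]] := fun i => bspan (p i).
exists (\sum_i N i)%N.
exists (fun i j => f ^+ (\sum_(i' | i' != i) N i') * c i j) => i.
rewrite (_ : _ - _ = f ^+ (\sum_(i' | i' != i) N i') *:
    (f ^+ N i *: p i - \sum_(j < d) c i j *: b j)); first exact: idealZ.
rewrite scalerBr scalerA -exprD scaler_sumr (bigD1 i) //= addnC.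
by congr (_ - _); apply: eq_bigr => j _; rewrite scalerA.
Qed.

End LocalBasis.
End SpecialFibre.

Lemma coordinates_lincomb (A : comNzRingType) (n : nat) (J : set {mpoly A[n]})
    (g : A) (k d : nat) (b : 'I_d -> {mpoly A[n]}) (p : 'I_k -> {mpoly A[n]})
    (q : {mpoly A[n]}) (e : 'I_k -> 'I_d -> A) (x : 'I_k -> A) :
  is_ideal J ->
  (forall i, J (g *: (p i * q) - \sum_(j < d) e i j *: b j)) ->
  J (g *: ((\sum_i x i *: p i) * q) -
     \sum_(j < d) (\sum_i x i * e i j) *: b j).
Proof.
move=> iJ Je.
rewrite (_ : _ - _ =
  \sum_i x i *: (g *: (p i * q) - \sum_(j < d) e i j *: b j)).
  by apply: ideal_sum => // i _; apply: idealZ.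
under [RHS]eq_bigr => i _ do rewrite scalerBr.
rewrite sumrB mulr_suml scaler_sumr; congr (_ - _).
  by apply: eq_bigr => i _; rewrite -scalerAl !scalerA mulrC.
under [RHS]eq_bigr => i _ do rewrite scaler_sumr.
rewrite exchange_big; apply: eq_bigr => j _; rewrite scaler_suml.
by apply: eq_bigr => i _; rewrite scalerA.
Qed.

(** * Closedness of the bound on the colon ideal *)

Section Closedness.
Variables (K : closedFieldType) (n : nat).

Definition extend_scalars (A : comAlgType K) (p : {mpoly K[n]}) :
  {mpoly A[n]} := map_mpoly (in_alg A) p.

Lemma map_extend_scalars (A : comAlgType K) (phi : {rmorphism A -> K}) p :
  is_Kpoint phi -> map_mpoly phi (extend_scalars A p) = p.
Proof.
by move=> phiK; apply/mpolyP => m; rewrite !mcoeff_map_mpoly /= phiK.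
Qed.

Lemma Kpoint_surj (A : comAlgType K) (phi : {rmorphism A -> K}) :
  is_Kpoint phi -> forall x : {mpoly K[n]}, exists p, map_mpoly phi p = x.
Proof.
by move=> phiK x; exists (extend_scalars A x); apply: map_extend_scalars.
Qed.

(** If the bound fails at phi0, c + 1 polynomials p i, finitely many sections
    q j of the ideal of the smaller subscheme and finitely many coordinates in a
    local basis form a matrix over A whose determinant is not killed by phi0.
    Where this determinant and the localizing element f do not vanish, the
    bound fails for the same p i. *)
Lemma colon_colength_closed c (d : 2.-tuple nat) :
  @hilb_closed K n 2 d
    (fun I => colon_colength_le c (tnth I ord0) (tnth I ord_max)).
Proof.
move=> A J [iJ _ flatJ].
pose S (phi : {rmorphism A -> K}) := colon_colength_le c
  (tnth (fibre phi J) ord0) (tnth (fibre phi J) ord_max).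
(* The ideal of functions that vanish at all points satisfying the bound. *)
exists [set a | forall phi : {rmorphism A -> K},
                  is_Kpoint phi -> S phi -> phi a = 0].
move=> phi0 phi0K; split=> [S0 a|E0]; first exact.
rewrite -/(S phi0); apply: contrapT => nS0.
have [p pP] := not_colon_colength_le nS0.
have {flatJ} [k [fs [gs [fg1 /= freeJ]]]] := flatJ ord_max.
(* The basic open sets D(fs i) cover the base, so one contains phi0. *)
have [i phifi] : exists i, phi0 (fs i) != 0.
  apply: contrapT => /forallNP nf; have /eqP := congr1 phi0 fg1.
  rewrite rmorph1 rmorph_sum big1 => [|i _]; first by rewrite eq_sym oner_eq0.
  rewrite rmorphM; have /negP := nf i.
  by rewrite negbK => /eqP ->; rewrite mulr0.
have {freeJ} [b [bspan bfree]] := freeJ i.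
move: (fs i) phifi bspan bfree => f phi0f bspan bfree {fs gs fg1 i k}.
have iJ1 := iJ ord0; have iJ2 := iJ ord_max.
set J1 := tnth J ord0 in iJ1; set J2 := tnth J ord_max in iJ2 bspan bfree.
set d2 := tnth d ord_max in b bspan bfree.
pose lifts (q : {mpoly A[n]}) N (e : 'I_c.+1 -> 'I_d2 -> A) := forall i,
  J2 (f ^+ N *: (extend_scalars A (p i) * q) - \sum_(j < d2) e i j *: b j).
have colonE (phi : {rmorphism A -> K}) q N e (a : 'cV[K]_c.+1) :
    is_Kpoint phi -> phi f != 0 -> lifts q N e ->
    tnth (fibre phi J) ord_max ((\sum_i a i 0 *: p i) * map_mpoly phi q) <->
    forall j, ((\row_i phi (e i j)) *m a) 0 0 = 0.
  move=> phiK phif eP.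
  have := fibre_coordinates (Kpoint_surj phiK) iJ2 phif bspan bfree
    (coordinates_lincomb (fun i => (a i 0)%:A) iJ2 eP).
  rewrite tnth_map rmorphM rmorph_sum /=.
  under eq_bigr => i _ do rewrite map_mpolyZ map_extend_scalars // phiK.
  have evE j : phi (\sum_i (a i 0)%:A * e i j) =
               ((\row_i phi (e i j)) *m a) 0 0.
    rewrite rmorph_sum mxE; apply: eq_bigr => i _.
    by rewrite mxE rmorphM /= phiK mulrC.
  by move=> ->; split=> e0 j; [rewrite -evE | rewrite evE].
pose V : set 'rV[K]_c.+1 := [set v | exists q N e j,
  [/\ J1 q, lifts q N e & v = \row_i phi0 (e i j)]].
have [|w [Vw unitw]] := @separating_rows K c.+1 V.
  move=> a /pP [x]; rewrite [tnth _ ord0]tnth_map.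
  move=> /(fibre_ideal_image (Kpoint_surj phi0K) _ iJ1) [q J1q <-].
  have [N [e eP]] := common_coordinates iJ2 bspan
    (fun i => extend_scalars A (p i) * q).
  rewrite (colonE phi0 q N e) // => /existsNP [j /eqP ej].
  exists (\row_i phi0 (e i j)); first by exists q, N, e, j.
  by apply: contra ej => /eqP ->; rewrite mxE.
have /choice[q /choice[N /choice[e /choice[j wP]]]] := Vw.
pose D := \matrix_(l, i) e l i (j l).
have mapD (phi : {rmorphism A -> K}) :
    map_mx phi D = \matrix_l \row_i phi (e l i (j l)).
  by apply/matrixP=> l i; rewrite !mxE.
have detD0 : phi0 (\det D) != 0.
  rewrite -det_map_mx mapD -unitfE -unitmxE.
  suff <- : \matrix_l w l = \matrix_l \row_i phi0 (e l i (j l)) by [].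
  by apply/row_matrixP=> l; rewrite !rowK; have [] := wP l.
suff /E0/eqP : forall phi : {rmorphism A -> K}, is_Kpoint phi -> S phi ->
    phi (f * \det D) = 0.
  by rewrite rmorphM mulf_eq0 (negPf phi0f) (negPf detD0).
move=> phi phiK Sphi; apply/eqP; apply: contraT.
rewrite rmorphM mulf_eq0 negb_or => /andP [phif].
rewrite -det_map_mx mapD -unitfE -unitmxE => unitD.
have [a aN0 aP] := Sphi p.
case/negP: aN0; apply/eqP; rewrite -[a](mulKmx unitD).
set M := \matrix_l _; suff -> : M *m a = 0 by rewrite mulmx0.
apply/row_matrixP=> l; rewrite row_mul rowK row0.
have [J1q liftq _] := wP l.
apply/rowP=> i; rewrite (ord1 i) [RHS]mxE.
apply: (colonE phi (q l) (N l) (e l) a phiK phif liftq).1; apply: aP.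
by rewrite tnth_map; apply: ideal_gen_in; exists (q l).
Qed.

End Closedness.

(** * Open conditions on the Grassmannian *)

Section GrassmannianOpen.
Variables (K : fieldType) (V : vectType K).
Local Notation N := (\dim {:V}).

(** The determinant is linear in the last row: g collects its cofactors. *)
Lemma det_last_row (k : nat) (B : 'M[K]_(k, k + 1)) :
  exists g : 'cV[K]_(k + 1), forall y, \det (col_mx B y) = (y *m g) 0 0.
Proof.
exists (\col_j cofactor (col_mx B 0) (rshift k ord0) j) => y.
rewrite (expand_det_row _ (rshift k ord0)) mxE; apply: eq_bigr => j _.
rewrite [\col__ _]lock mxE -lock; case: splitP => [i /= /eqP|i _]; last first.
  rewrite (ord1 i) mxE /cofactor; congr (_ * (_ * \det _)).
  apply/matrixP=> r l; rewrite !mxE; case: splitP => // i0 /= /eqP.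
  by rewrite /bump (ord1 i0) /= addn0; have := ltn_ord r; lia.
by have := ltn_ord i; lia.
Qed.

Definition coords (v : V) : 'rV[K]_N := \row_l coord (vbasis {:V}) l v.

Lemma coords_is_linear : linear coords.
Proof. by move=> a u v; apply/rowP=> l; rewrite !mxE linearP. Qed.

HB.instance Definition _ :=
  GRing.isLinear.Build K V 'rV[K]_N _ coords coords_is_linear.

Lemma coords_inj : injective coords.
Proof.
move=> u v /rowP uv; rewrite (coord_vbasis (memvf u)) (coord_vbasis (memvf v)).
by apply: eq_bigr => l _; have := uv l; rewrite !mxE => ->.
Qed.

Section Frame.
Variables (k : nat) (X : k.-tuple V).
Hypothesis freeX : free X.

Definition frame_mx : 'M[K]_(k, N) := \matrix_t coords (tnth X t).

(** The frame bordered with v is a (k + 1) x N matrix.  For C with one nonzero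
    entry 1 in each column this is one of its maximal minors; arbitrary C make
    a choice of columns unnecessary. *)
Definition frame_minor (C : 'M[K]_(N, k + 1)) (v : V) : K :=
  \det (col_mx frame_mx (coords v) *m C).

Lemma frame_minor_sum C c (a : 'cV[K]_c) (y : 'I_c -> V) :
  frame_minor C (\sum_i a i 0 *: y i) = \sum_i a i 0 * frame_minor C (y i).
Proof.
have [g gE] := det_last_row (frame_mx *m C).
rewrite /frame_minor mul_col_mx gE linear_sum !mulmx_suml summxE.
apply: eq_bigr => i _; rewrite mul_col_mx gE linearZ -!scalemxAl.
by rewrite [LHS]mxE.
Qed.

Lemma frame_mx_combination (u : 'rV[K]_k) :
  u *m frame_mx = coords (\sum_t u 0 t *: tnth X t).
Proof.
rewrite mulmx_sum_row linear_sum; apply: eq_bigr => t _.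
by rewrite rowK linearZ.
Qed.

Lemma frame_spanP v :
  reflect (exists u : 'rV[K]_k, v = \sum_t u 0 t *: tnth X t) (v \in <<X>>%VS).
Proof.
apply: (iffP idP) => [/coord_span ->|[u ->]].
  exists (\row_t coord X t v); apply: eq_bigr => t _.
  by rewrite mxE (tnth_nth 0).
by apply: rpred_sum => t _; apply: rpredZ; apply: memv_span; apply: mem_tnth.
Qed.

(** The bordered frame has full rank exactly when v is outside the span, and
    then C can be a right inverse. *)
Lemma frame_minorP v :
  reflect (exists C, frame_minor C v != 0) (v \notin <<X>>%VS).
Proof.
apply: (iffP idP) => [vX|[C]]; last first.
  apply: contra => /frame_spanP [u vE]; apply/det0P; exists (row_mx u (- 1%:M)).
    apply: contra (oner_neq0 K); rewrite -row_mx0.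
    move=> /eqP/eq_row_mx [_ /rowP/(_ 0)].
    by rewrite !mxE eqxx => /eqP; rewrite oppr_eq0.
  rewrite mulmxA mul_row_col frame_mx_combination -vE mulNmx mul1mx.
  by rewrite subrr mul0mx.
have freeXv : row_free (col_mx frame_mx (coords v)).
  apply: row_free_col_mx.
    rewrite -kermx_eq0; apply/rowV0P=> u /sub_kermxP.
    rewrite frame_mx_combination -(raddf0 coords) => /coords_inj uX.
    apply/rowP=> t; rewrite [RHS]mxE; apply: (freeP freeX (fun t => u 0 t)).
    by rewrite -[RHS]uX; apply: eq_bigr => t' _; rewrite (tnth_nth 0).
  apply: contra vX => /submxP [u]; rewrite frame_mx_combination => /coords_inj.
  by move=> vE; apply/frame_spanP; exists u.
have [C CE] := row_freeP freeXv.
by exists C; rewrite /frame_minor CE det1 oner_neq0.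
Qed.

End Frame.

Section UniversalFrame.
Variable k : nat.
Local Notation frameP := {mpoly K[k * N]}.
Local Notation constP := (@mpolyC (k * N) K).

(** Here the frame is generic: its entries are the variables that [frame_coord]
    evaluates. *)
Definition universal_minor (C : 'M[K]_(N, k + 1)) (v : V) : frameP :=
  \det (col_mx (\matrix_(t, l) 'X_(mxvec_index t l)) (map_mx constP (coords v))
        *m map_mx constP C).

Lemma meval_universal_minor (X : k.-tuple V) C v :
  (universal_minor C v).@[frame_coord X] = frame_minor X C v.
Proof.
rewrite -det_map_mx map_mxM map_col_mx; congr (\det (col_mx _ _ *m _)).
- by apply/matrixP=> t l; rewrite !mxE /= mevalXU /frame_coord mxvecE !mxE.
- by apply/matrixP=> t l; rewrite !mxE /= mevalC.
- by apply/matrixP=> t l; rewrite !mxE /= mevalC.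
Qed.

(** For a fixed frame and fixed C the minor is linear in v and vanishes on H.
    So H is avoided as required exactly when the functionals
    a |-> minor of (sum of the a i y i j), for all j and C, have no common
    zero; by [separating_rows] this is the nonvanishing of one of the
    determinants formed with c of them. *)
Lemma Gr_open_avoiding (c : nat) (T : Type) (y : 'I_c -> T -> V) :
  Gr_open k [set H : {vspace V} | \dim H = k /\
    forall a : 'cV[K]_c, a != 0 -> exists j, \sum_i a i 0 *: y i j \notin H].
Proof.
split; first by move=> H [].
pose P (j : 'I_c -> T) C :=
  \det (\matrix_l \row_i universal_minor (C l) (y i (j l))).
exists [set p | exists j C, p = P j C] => X freeX.
pose Q (j : 'I_c -> T) C := \matrix_l \row_i frame_minor X (C l) (y i (j l)).
have PE j C : (P j C).@[frame_coord X] = \det (Q j C).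
  rewrite -det_map_mx; congr (\det _); apply/matrixP=> l i.
  by rewrite !mxE /= meval_universal_minor.
have rowE C j (a : 'cV[K]_c) : ((\row_i frame_minor X C (y i j)) *m a) 0 0 =
    frame_minor X C (\sum_i a i 0 *: y i j).
  by rewrite frame_minor_sum mxE; apply: eq_bigr => i _; rewrite mxE mulrC.
split=> [[_ avoid]|[_ [j [C ->]]]].
  pose W : set 'rV[K]_c :=
    [set v | exists j C, v = \row_i frame_minor X C (y i j)].
  have [|w [Ww unitw]] := @separating_rows K c W.
    move=> a /avoid [j /(frame_minorP freeX) [C Ca]].
    exists (\row_i frame_minor X C (y i j)); first by exists j, C.
    by apply: contra Ca => /eqP a0; rewrite -rowE a0 mxE.
  have /choice[j /choice[C wE]] := Ww.
  exists (P j C); first by exists j, C.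
  rewrite PE -unitfE -unitmxE (_ : Q j C = \matrix_l w l) //.
  by apply/row_matrixP=> l; rewrite !rowK wE.
rewrite PE -unitfE -unitmxE => unitQ; split.
  by apply/eqP; rewrite -[X in _ == X](size_tuple X).
move=> a aN0; apply: contrapT => /forallNP inX; case/negP: aN0; apply/eqP.
rewrite -[a](mulKmx unitQ) (_ : Q j C *m a = 0) ?mulmx0 //.
apply/row_matrixP=> l; rewrite row_mul rowK row0; apply/rowP=> i.
rewrite (ord1 i) rowE [RHS]mxE; apply/eqP; apply: contraT => minorN0.
by case: (inX (j l)); apply/(frame_minorP freeX); exists (C l).
Qed.

End UniversalFrame.
End GrassmannianOpen.

(** * Powers of monomial ideals and the ideal of the smaller subscheme *)

Section Order.
Variables (K : fieldType) (n : nat).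
Implicit Types (p q : {mpoly K[n]}) (m : 'X_{1..n}) (P : set 'I_n).

(** The k-th power of the maximal ideal, see [max_ideal_powE]. *)
Definition order_ge (k : nat) : set {mpoly K[n]} :=
  [set p | forall m, (mdeg m < k)%N -> p@_m = 0].

Lemma order_geM k l p q :
  order_ge k p -> order_ge l q -> order_ge (k + l) (p * q).
Proof.
move=> pk ql m mkl; rewrite mcoeffM big1 // => -[m1 m2] /= /eqP mE.
have [ltk|lek] := ltnP (mdeg m1) k; first by rewrite pk ?mul0r.
rewrite ql ?mulr0 //; have := congr1 mdeg mE; rewrite mdegD; lia.
Qed.

Lemma order_ge_ideal k : is_ideal (order_ge k).
Proof.
split=> [m _|p q pk qk m mk|a p pk].
- by rewrite mcoeff0.
- by rewrite mcoeffD pk // qk // addr0.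
- by rewrite -[k]add0n; apply: order_geM.
Qed.

Lemma order_geS k l p : (k <= l)%N -> order_ge l p -> order_ge k p.
Proof. by move=> lekl pl m mk; apply: pl; apply: leq_trans lekl. Qed.

Lemma order_ge1P p : order_ge 1 p <-> p@_0%MM = 0.
Proof.
split=> [|p0 m]; first by apply; rewrite mdeg0.
by rewrite ltnS leqn0 mdeg_eq0 => /eqP ->.
Qed.

Lemma order_ge_subC a : order_ge 1 (a - (a@_0%MM)%:MP).
Proof. by apply/order_ge1P; rewrite mcoeffB mcoeffC eqxx mulr1 subrr. Qed.

(** Below and at the order of p, only the constant term of a matters. *)
Lemma mcoeffM_order_ge k a p m :
  order_ge k p -> (mdeg m <= k)%N -> (a * p)@_m = a@_0%MM * p@_m.
Proof.
move=> pk mk; rewrite -[a in LHS](subrK (a@_0%MM)%:MP) mulrDl mcoeffD mcoeffCM.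
by rewrite (order_geM (order_ge_subC a) pk) ?add0r.
Qed.

Lemma mcoeffXU_deg m i : (mdeg m != 1)%N -> ('X_i : {mpoly K[n]})@_m = 0.
Proof.
by move=> mN1; rewrite mcoeffX; case: (_ =P m) mN1 => [<-|//]; rewrite mdeg1.
Qed.

Lemma order_ge_var i : order_ge 1 'X_i.
Proof. by apply/order_ge1P; rewrite mcoeffXU_deg // mdeg0. Qed.

Lemma ideal_monomials (I : set {mpoly K[n]}) p : is_ideal I ->
  (forall m, p@_m != 0 -> I 'X_[m]) -> I p.
Proof.
move=> iI pI; rewrite [p]mpolyE big_seq; apply: (ideal_sum iI) => m.
by rewrite mcoeff_msupp => /pI Im; apply: idealZ.
Qed.

Lemma monomial_factor m i : m i != 0%N ->
  'X_[m] = 'X_i * 'X_[m - U_(i)] :> {mpoly K[n]}.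
Proof. by move=> mi; rewrite -mpolyXD addmC submK // lep1mP. Qed.

Lemma vars_ideal_monomial P m i : P i -> m i != 0%N ->
  vars_ideal K n P 'X_[m].
Proof.
move=> Pi mi; rewrite (monomial_factor mi).
apply: (idealMr (ideal_gen_ideal _)).
by apply: ideal_gen_in; exists i.
Qed.

Lemma vars_ideal_order P : vars_ideal K n P `<=` order_ge 1.
Proof.
apply: ideal_gen_min; first exact: order_ge_ideal.
by move=> _ [i _ <-]; apply: order_ge_var.
Qed.

Lemma ideal_pow_ideal P k : is_ideal (ideal_pow (vars_ideal K n P) k).
Proof. by case: k => [|k]; [split | apply: ideal_gen_ideal]. Qed.

Lemma ideal_pow_order P k : ideal_pow (vars_ideal K n P) k `<=` order_ge k.
Proof.
elim: k => [|k IHk]; first by move=> p _ m.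
apply: ideal_gen_min; first exact: order_ge_ideal.
move=> _ [p Pp [q Iq <-]]; rewrite -add1n; apply: order_geM.
  exact: vars_ideal_order Pp.
exact: IHk.
Qed.

Lemma ideal_pow_monomial P k m : (forall i, m i != 0%N -> P i) ->
  (k <= mdeg m)%N -> ideal_pow (vars_ideal K n P) k 'X_[m].
Proof.
elim: k m => [//|k IHk] m mP mk.
have [i mi] : exists i, m i != 0%N.
  apply/existsP; apply: contraLR mk => /existsPn m0.
  rewrite mdegE big1 // => i _; apply/eqP; have := m0 i; by rewrite negbK.
rewrite (monomial_factor mi); apply: ideal_mul_in.
  by apply: ideal_gen_in; exists i => //; apply: mP.
apply: IHk => [j|].
  by rewrite mnmBE => mj; apply: mP; apply: contra mj => /eqP ->.
have : mdeg m = mdeg (U_(i) + (m - U_(i)))%MM.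
  by rewrite addmC submK // lep1mP.
by rewrite mdegD mdeg1; move: mk; lia.
Qed.

Lemma max_ideal_powE k p : ideal_pow (max_ideal K n) k p <-> order_ge k p.
Proof.
split; first exact: ideal_pow_order.
move=> pk; apply: ideal_monomials; first exact: ideal_pow_ideal.
move=> m pm; apply: ideal_pow_monomial => //.
by rewrite leqNgt; apply: contra pm => /pk ->.
Qed.

Lemma ideal1_ideal s : is_ideal (ideal1 K n s).
Proof.
apply: ideal_add_ideal; [exact: ideal_pow_ideal | exact: ideal_gen_ideal].
Qed.

(** Both sides are spanned by monomials.  A monomial other than 1 and the x_i
    with i < s is divisible by some x_j with j >= s or by a product of two of
    the first s variables. *)
Lemma ideal1P s p : ideal1 K n s p <->
  p@_0%MM = 0 /\ forall i : 'I_n, (i < s)%N -> p@_U_(i) = 0.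
Proof.
split=> [|[p0 ps]].
  have iL : is_ideal [set p : {mpoly K[n]} |
      p@_0%MM = 0 /\ forall i : 'I_n, (i < s)%N -> p@_U_(i) = 0].
    split=> [|p1 p2 [p10 p1s] [p20 p2s]|a p1 [p10 p1s]].
    - by split=> [|i _]; rewrite mcoeff0.
    - rewrite /= mcoeffD p10 p20 addr0; split=> // i si.
      by rewrite mcoeffD p1s // p2s // addr0.
    - have p1_1 : order_ge 1 p1 by apply/order_ge1P.
      rewrite /= (mcoeffM_order_ge a p1_1) ?mdeg0 // p10 mulr0; split=> // i si.
      by rewrite (mcoeffM_order_ge a p1_1) ?mdeg1 // p1s // mulr0.
  apply: (ideal_add_min iL).
    move=> q /ideal_pow_order q2; split=> [|i _]; apply: q2.
      by rewrite mdeg0.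
    by rewrite mdeg1.
  apply: (ideal_gen_min iL) => _ [i /= si <-]; split=> [|j js].
    by rewrite mcoeffXU_deg ?mdeg0.
  rewrite mcoeffXU; case: eqP => // ij; move: si; rewrite ij; lia.
apply: ideal_monomials; first exact: ideal1_ideal.
move=> m pm.
have [/existsP [i /andP [si mi]]|/existsPn small] :=
    boolP [exists i : 'I_n, (s <= i)%N && (m i != 0%N)].
  apply: ideal_add_inr; first exact: ideal_pow_ideal.
  exact: vars_ideal_monomial si mi.
have ms i : m i != 0%N -> (i < s)%N.
  by move=> mi; have := small i; rewrite mi andbT -ltnNge.
apply: ideal_add_inl; first exact: ideal_gen_ideal.
apply: ideal_pow_monomial; first exact: ms.
rewrite ltn_neqAle lt0n mdeg_eq0 eq_sym.
apply/andP; split; apply: contra pm; last by move=> /eqP ->; rewrite p0.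
by move=> /mdeg1P [i /eqP mE]; rewrite mE ps // ms // mE mnm1E eqxx.
Qed.

End Order.

(** * The ideal of the larger subscheme *)

Section Quadrics.
Variables (K : fieldType) (m : nat).
Local Notation n := m.+1.
Local Notation quadric := (dhomog n K 2).
Implicit Types (p q : {mpoly K[n]}) (H : {vspace quadric}).

Lemma mpoly_dhomog0 : mpoly_of_dhomog (0 : quadric) = 0.
Proof. by []. Qed.

Lemma mpoly_dhomogB (q r : quadric) :
  mpoly_of_dhomog (q - r) = mpoly_of_dhomog q - mpoly_of_dhomog r.
Proof. by []. Qed.

Lemma mpoly_dhomogD (q r : quadric) :
  mpoly_of_dhomog (q + r) = mpoly_of_dhomog q + mpoly_of_dhomog r.
Proof. by []. Qed.

Lemma mpoly_dhomogZ a (q : quadric) :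
  mpoly_of_dhomog (a *: q) = a *: mpoly_of_dhomog q.
Proof. by []. Qed.

Lemma quadric_coeff (q : quadric) u : mdeg u != 2 -> (q : {mpoly K[n]})@_u = 0.
Proof. by move=> u2; apply: dhomog_nemf_coeff u2; apply: dhomog_is_dhomog. Qed.

Lemma quadric_order (q : quadric) : order_ge 2 (q : {mpoly K[n]}).
Proof. by move=> u u2; apply: quadric_coeff; rewrite neq_ltn u2. Qed.

Lemma quadric_order3 (q : quadric) : order_ge 3 (q : {mpoly K[n]}) -> q = 0.
Proof.
move=> q3; apply/val_inj/mpolyP => u /=; rewrite mcoeff0.
have [u3|u3] := ltnP (mdeg u) 3; first exact: q3.
by apply: quadric_coeff; rewrite neq_ltn u3 orbT.
Qed.

Definition quad_part p : quadric := DHomog (pihomogP mdeg 2 p).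

Lemma quad_part_is_linear : linear quad_part.
Proof. by move=> a p q; apply: val_inj; rewrite /= linearP. Qed.

HB.instance Definition _ :=
  GRing.isLinear.Build K {mpoly K[n]} quadric _ quad_part quad_part_is_linear.

Lemma mcoeff_quad_part p u :
  mdeg u = 2 -> (quad_part p : {mpoly K[n]})@_u = p@_u.
Proof.
move=> u2; rewrite [p in RHS]mpolyE (bigID (fun v => mdeg v == 2)) /= mcoeffD.
rewrite [X in _ = _ + X]raddf_sum [X in _ = _ + X]big1 ?addr0 // => v v2.
rewrite /= mcoeffZ mcoeffX.
case: (v =P u) v2 => [->|_ _]; last by rewrite mulr0.
by rewrite u2.
Qed.

Lemma quad_part_order p :
  order_ge 2 p -> order_ge 3 (p - mpoly_of_dhomog (quad_part p)).
Proof.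
move=> p2 u; rewrite ltnS leq_eqVlt mcoeffB => /predU1P [u2|u2].
  by rewrite mcoeff_quad_part // subrr.
by rewrite p2 // quadric_coeff ?subrr // neq_ltn u2.
Qed.

Lemma quad_part_eq0 p : (forall u, mdeg u = 2 -> p@_u = 0) -> quad_part p = 0.
Proof.
move=> p2; apply: val_inj; apply/mpolyP => u /=; rewrite mcoeff0.
have [u2|u2] := eqVneq (mdeg u) 2.
  by rewrite -[RHS](p2 u u2) -[RHS](mcoeff_quad_part p u2).
exact: (quadric_coeff (quad_part p)).
Qed.

Lemma quad_part_quadric (q : quadric) : quad_part q = q.
Proof.
by apply: val_inj; rewrite /= pihomog_dE //; apply: dhomog_is_dhomog.
Qed.

Lemma ideal2_ideal H : is_ideal (ideal2 H).
Proof.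
by apply: ideal_add_ideal; [exact: ideal_gen_ideal | exact: ideal_pow_ideal].
Qed.

(** Modulo cubics, multiplying h in H by a polynomial a only multiplies it by
    the constant term of a, so H + m^3 is already an ideal. *)
Lemma ideal2P H p :
  ideal2 H p <->
  exists2 h : quadric, h \in H & order_ge 3 (p - mpoly_of_dhomog h).
Proof.
split=> [|[h hH p3]]; last first.
  rewrite -[p](subrK (mpoly_of_dhomog h)) addrC; exists (mpoly_of_dhomog h).
    by apply: ideal_gen_in; exists h.
  by exists (p - mpoly_of_dhomog h) => //; apply/max_ideal_powE.
have iL : is_ideal [set p : {mpoly K[n]} |
    exists2 h : quadric, h \in H & order_ge 3 (p - mpoly_of_dhomog h)].
  have i3 := order_ge_ideal K n 3.
  split=> [|p1 p2 [h1 h1H p1h] [h2 h2H p2h]|a p1 [h hH ph]].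
  - by exists 0; [exact: mem0v | rewrite subrr; exact: ideal0].
  - exists (h1 + h2); first exact: memvD.
    rewrite (_ : _ - _ =
      (p1 - mpoly_of_dhomog h1) + (p2 - mpoly_of_dhomog h2)).
      exact: (idealD i3).
    by rewrite mpoly_dhomogD; ring.
  - exists (a@_0%MM *: h); first exact: memvZ.
    rewrite (_ : _ - _ = a * (p1 - mpoly_of_dhomog h) +
                         (a - (a@_0%MM)%:MP) * mpoly_of_dhomog h).
      apply: (idealD i3); first exact: (idealMl i3).
      exact: (order_geM (order_ge_subC a) (quadric_order h)).
    by rewrite mpoly_dhomogZ -mul_mpolyC; ring.
apply: (ideal_add_min iL).
  apply: (ideal_gen_min iL) => _ [h /= hH <-]; exists h => //.
  by rewrite subrr; apply: (ideal0 (order_ge_ideal K n 3)).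
move=> q /max_ideal_powE q3; exists 0; first exact: mem0v.
by rewrite mpoly_dhomog0 subr0.
Qed.

Lemma ideal2_quadric H (q : quadric) : ideal2 H q -> q \in H.
Proof.
move=> /ideal2P [h hH]; rewrite -mpoly_dhomogB => /quadric_order3/eqP.
by rewrite subr_eq0 => /eqP ->.
Qed.

Lemma ideal2_coeffP H p : ideal2 H p <-> order_ge 2 p /\ quad_part p \in H.
Proof.
split=> [/ideal2P [h hH ph]|[p2 pH]]; last first.
  by apply/ideal2P; exists (quad_part p) => //; apply: quad_part_order.
have p2 : order_ge 2 p.
  rewrite -[p](subrK (mpoly_of_dhomog h)).
  apply: (idealD (order_ge_ideal _ _ _)).
    exact: order_geS ph.
  exact: quadric_order.
split=> //; suff -> : quad_part p = h by [].
apply/eqP; rewrite -subr_eq0; apply/eqP/quadric_order3; rewrite mpoly_dhomogB.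
rewrite (_ : _ - _ = (p - mpoly_of_dhomog h) -
                     (p - mpoly_of_dhomog (quad_part p))); last by ring.
by apply: (idealB (order_ge_ideal _ _ _)) => //; apply: quad_part_order.
Qed.

Lemma ideal2_sub_ideal1 H s : ideal2 H `<=` ideal1 K n s.
Proof.
move=> p /ideal2_coeffP [p2 _]; apply/ideal1P.
by split=> [|i _]; apply: p2; rewrite ?mdeg0 ?mdeg1.
Qed.

End Quadrics.

Section Projection.
Variables (K : fieldType) (V : vectType K).

(** The map v |-> v - proj v has kernel H, so coordinates on its image are
    coordinates on V/H. *)
Lemma quotient_coordinates (H : {vspace V}) :
  exists f : {linear V -> 'rV[K]_(\dim {:V} - \dim H)},
    (forall v, (v \in H) = (f v == 0)) /\ (forall r, exists v, f v = r).
Proof.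
pose g : 'End(V) := (\1 - projv H)%VF.
have gE v : (v \in H) = (g v == 0).
  rewrite !lfun_simp subr_eq0 /=; apply/idP/eqP => [/projv_id -> //|->].
  exact: memv_proj.
have -> : (\dim {:V} - \dim H = \dim (limg g))%N.
  rewrite -(limg_ker_dim g fullv) capfv (_ : lker g = H) ?addKn //.
  by apply/vspaceP=> v; rewrite memv_ker gE.
set W := limg g; pose f v : 'rV[K]_(\dim W) := \row_i coord (vbasis W) i (g v).
have linf : linear f by move=> a u v; apply/rowP=> i; rewrite !mxE !linearP.
pose fL : {linear V -> 'rV[K]_(\dim W)} :=
  HB.pack f (GRing.isLinear.Build K V 'rV[K]_(\dim W) _ f linf).
exists fL; split=> [v|r].
  rewrite gE; apply/eqP/eqP => [gv|/rowP fv].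
    by apply/rowP=> i; rewrite !mxE gv linear0.
  have gW : g v \in W by apply: memv_img; apply: memvf.
  rewrite (coord_vbasis gW) big1 // => i _.
  by have := fv i; rewrite !mxE => ->; rewrite scale0r.
have /memv_imgP [v _ vE] : \sum_i r 0 i *: (vbasis W)`_i \in W.
  apply: rpred_sum => i _.
  by rewrite rpredZ // vbasis_mem // mem_nth ?size_tuple.
exists v; apply/rowP=> i; rewrite mxE -vE coord_sum_free //.
exact: basis_free (vbasisP W).
Qed.

End Projection.

Section HilbertPoint.
Variables (K : closedFieldType) (m : nat).
Local Notation n := m.+1.
Local Notation quadric := (dhomog n K 2).

Lemma mcoeff_linear_form (a : 'I_n -> K) (u : 'X_{1..n}) : mdeg u != 1 ->
  (\sum_i a i *: 'X_i : {mpoly K[n]})@_u = 0.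
Proof.
move=> u1; rewrite raddf_sum big1 //= => i _.
by rewrite mcoeffZ mcoeffXU_deg ?mulr0.
Qed.

Lemma mcoeffU_linear_form (a : 'I_n -> K) j :
  (\sum_i a i *: 'X_i : {mpoly K[n]})@_U_(j) = a j.
Proof.
rewrite raddf_sum (bigD1 j) //= mcoeffZ mcoeffXU eqxx mulr1.
rewrite big1 ?addr0 // => i ij.
by rewrite mcoeffZ mcoeffXU (negPf ij) mulr0.
Qed.

Lemma mcoeffC_pos (c : K) (u : 'X_{1..n}) : mdeg u != 0 -> c%:MP@_u = 0.
Proof. by rewrite mdeg_eq0 mcoeffC => /negPf ->; rewrite mulr0. Qed.

Lemma quot_dim_ideal1 s : (s <= n)%N -> quot_dim (ideal1 K n s) (1 + s).
Proof.
move=> les.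
pose f (p : {mpoly K[n]}) : 'rV[K]_(1 + s) :=
  row_mx (const_mx p@_0%MM) (\row_i p@_U_(widen_ord les i)).
have linf : linear f.
  move=> a p q; rewrite /f scale_row_mx add_row_mx.
  by congr row_mx; apply/rowP=> i; rewrite !mxE mcoeffD mcoeffZ.
pose L : {linear {mpoly K[n]} -> 'rV[K]_(1 + s)} :=
  HB.pack f (GRing.isLinear.Build K {mpoly K[n]} 'rV[K]_(1 + s) _ f linf).
apply: (linear_quot_dim (L := L)) => [p|v].
  rewrite ideal1P /= /f -row_mx0.
  split=> [[p0 ps]|/eq_row_mx [/rowP p0 /rowP ps]].
    rewrite p0; congr row_mx.
    by apply/rowP=> i; rewrite !mxE; apply: ps; apply: (ltn_ord i).
  split=> [|i si]; first by have := p0 0; rewrite !mxE.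
  have := ps (Ordinal si); rewrite !mxE.
  by congr (_@_U_(_) = _); apply: val_inj.
pose a (i : 'I_n) :=
  if insub (val i) is Some j then (rsubmx v : 'rV_s) 0 j else 0.
exists (((lsubmx v : 'rV_1) 0 0)%:MP + \sum_i a i *: 'X_i).
rewrite /= /f -[RHS]hsubmxK; congr row_mx; apply/rowP=> i.
  rewrite mxE mcoeffD mcoeffC eqxx mulr1 mcoeff_linear_form ?mdeg0 //.
  by rewrite addr0 (ord1 i).
rewrite mxE mcoeffD mcoeffC_pos ?mdeg1 // add0r mcoeffU_linear_form /a /=.
by rewrite insubT //= => lti; congr (_ 0 _); apply: val_inj.
Qed.

Lemma quot_dim_ideal2 (H : {vspace quadric}) :
  (\dim {:quadric} - \dim H = 2)%N -> quot_dim (ideal2 H) (n + 3).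
Proof.
change (n + 3)%N with (n + (1 + 2))%N.
move=> codimH; have [g [gH gsurj]] := quotient_coordinates H.
move: g gH gsurj; rewrite codimH => g gH gsurj.
pose f (p : {mpoly K[n]}) : 'rV[K]_(n + (1 + 2)) :=
  row_mx (\row_i p@_U_(i))
    (row_mx (const_mx p@_0%MM) (g (quad_part p))).
have linf : linear f.
  move=> a p q; have gE : g (quad_part (a *: p + q)) =
      a *: g (quad_part p) + g (quad_part q) by rewrite !linearP.
  rewrite /f !scale_row_mx !add_row_mx gE.
  congr row_mx; first by apply/rowP=> i; rewrite !mxE mcoeffD mcoeffZ.
  congr row_mx.
  by apply/rowP=> i; rewrite !mxE mcoeffD mcoeffZ.
pose L : {linear {mpoly K[n]} -> 'rV[K]_(n + (1 + 2))} :=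
  HB.pack f (GRing.isLinear.Build K {mpoly K[n]} 'rV[K]_(n + (1 + 2)) _ f linf).
apply: (linear_quot_dim (L := L)) => [p|v].
  rewrite ideal2_coeffP gH /= /f -row_mx0; split=> [[p2 /eqP ->]|].
    congr row_mx; first by apply/rowP=> i; rewrite !mxE p2 ?mdeg1.
    by rewrite p2 ?mdeg0 // -[RHS]row_mx0; congr row_mx.
  move=> /eq_row_mx [/rowP p1 /eqP]; rewrite -row_mx0 => /eqP.
  move=> /eq_row_mx [/rowP/(_ 0) p0 ->]; split=> // u.
  rewrite ltnS leq_eqVlt ltnS leqn0 mdeg_eq0.
  move=> /predU1P [/eqP/mdeg1P [i /eqP ->]|/eqP ->].
    by have := p1 i; rewrite !mxE.
  by move: p0; rewrite !mxE.
pose w : 'rV_(1 + 2) := rsubmx v.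
have [q qE] := gsurj (rsubmx w).
exists ((\sum_i (lsubmx v : 'rV_n) 0 i *: 'X_i) +
        ((lsubmx w : 'rV_1) 0 0)%:MP + mpoly_of_dhomog q).
rewrite /= /f -[RHS]hsubmxK; congr row_mx.
  apply/rowP=> i; rewrite mxE !mcoeffD mcoeffU_linear_form.
  by rewrite mcoeffC_pos ?quadric_coeff ?mdeg1 // !addr0.
rewrite -[RHS]/w -[RHS]hsubmxK; congr row_mx.
  apply/rowP=> i; rewrite mxE !mcoeffD mcoeff_linear_form ?mdeg0 //.
  rewrite mcoeffC eqxx mulr1.
  by rewrite quadric_coeff ?mdeg0 // add0r addr0 (ord1 i).
rewrite -qE; congr (g _).
rewrite linearD /= quad_part_quadric -[RHS]add0r; congr (_ + _).
apply: quad_part_eq0 => u u2; rewrite mcoeffD mcoeff_linear_form ?u2 //.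
by rewrite mcoeffC_pos ?u2 ?addr0.
Qed.

Lemma hilb_point_ideals s (H : {vspace quadric}) : (s <= n)%N ->
  (\dim {:quadric} - \dim H = 2)%N ->
  hilb_point [tuple (1 + s)%N; (n + 3)%N] [tuple ideal1 K n s; ideal2 H].
Proof.
move=> les codimH; split.
- by case=> [[|[|//]] i] //=; [exact: ideal1_ideal | exact: ideal2_ideal].
- case=> [[|[|//]] i]; case=> [[|[|//]] j] //= _ p //=.
  exact: ideal2_sub_ideal1.
- case=> [[|[|//]] i] /=; first exact: quot_dim_ideal1.
  exact: quot_dim_ideal2.
Qed.

End HilbertPoint.
(** * Generic codimension two spaces of quadrics *)

Section SpecialPencil.
Variables (K : fieldType) (m s : nat).
Local Notation n := m.+1.
Local Notation quadric := (dhomog n K 2).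
Local Notation c := (n - s + 2)%N.

Lemma var2_homog (i j : 'I_n) : ('X_i * 'X_j : {mpoly K[n]}) \is 2.-homog.
Proof. by rewrite -mpolyXD dhomogX /= mdegD !mdeg1. Qed.

Definition var2 (i j : 'I_n) : quadric := DHomog (var2_homog i j).

Lemma eq_mnm2 (i j k l : 'I_n) : ((U_(i) + U_(j))%MM == (U_(k) + U_(l))%MM) =
  ((i == k) && (j == l)) || ((i == l) && (j == k)).
Proof.
apply/eqP/idP => [/mnmP E|/orP[]/andP[/eqP-> /eqP->]//]; last exact: addmC.
have := E i; have := E j; rewrite !mnmDE !mnm1E !eqxx.
rewrite [k == i]eq_sym [l == i]eq_sym [k == j]eq_sym [l == j]eq_sym.
have [->|ij] := eqVneq i j; first by case: (j == k); case: (j == l).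
have [ik|ik] := eqVneq i k; have [il|il] := eqVneq i l;
  have [jk|jk] := eqVneq j k; have [jl|jl] := eqVneq j l => //= _ _;
  by case/eqP: ij; rewrite ?ik ?jk // il jl.
Qed.

Lemma mcoeff_var2 (i j k l : 'I_n) :
  (var2 i j : {mpoly K[n]})@_(U_(k) + U_(l)) =
  (((i == k) && (j == l)) || ((i == l) && (j == k)))%:R.
Proof. by rewrite /= -mpolyXD mcoeffX eq_mnm2. Qed.

(** The c variables x_0, x_1, x_s, ..., x_(n-1), counted from 0. *)
Definition probe (k : 'I_c) : 'I_n :=
  inord (if (k < 2)%N then k : nat else k - 2 + s)%N.

Definition tail := {j : 'I_n | (s <= j)%N}.

Definition product_form (k : 'I_c) (j : tail) : quadric :=
  var2 (probe k) (val j).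

(** The constant 1 and the c variables x_(probe k) are independent modulo
    (I2 : I1).  The ideal I1 contains every quadric, which rules out constant
    terms, and the variables x_j with j >= s, which by the hypothesis on H
    rule out linear forms in the x_(probe k). *)
Lemma avoiding_not_colon_colength (H : {vspace quadric}) : H != fullv ->
  (forall a : 'cV[K]_c, a != 0 ->
     exists j, \sum_i a i 0 *: product_form i j \notin H) ->
  ~ colon_colength_le c (ideal1 K n s) (ideal2 H).
Proof.
move=> Hproper avoid.
pose x k : {mpoly K[n]} := 'X_(probe k).
move=> /(_ (fun i => if unlift ord0 i is Some k then x k else 1)).
case=> a /negP aN0 Ia; apply/aN0/eqP => {aN0}.
pose a' : 'cV[K]_c := \col_k a (lift ord0 k) 0.
pose l := \sum_k a' k 0 *: x k.
have {}Ia q : ideal1 K n s q -> ideal2 H ((a ord0 0 *: 1 + l) * q).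
  move=> /Ia; rewrite big_ord_recl unlift_none.
  rewrite (_ : \sum__ _ = l) //; apply: eq_bigr => k _.
  by rewrite liftK mxE.
have l1 : order_ge 1 l.
  apply: (ideal_sum (order_ge_ideal K n 1)) => k _.
  apply: (idealZ _ (order_ge_ideal K n 1)); exact: order_ge_var.
(* For a quadric w outside H, (a0 + l) w is a0 w up to a cubic. *)
have a0 : a ord0 0 = 0.
  have [w wH] : exists w, w \notin H.
    apply: contrapT => /forallNP inH; case/negP: Hproper.
    apply/eqP/vspaceP=> w; rewrite memvf; apply/negPn/negP; exact: inH.
  have I1w : ideal1 K n s (mpoly_of_dhomog w).
    apply/ideal1P; have w2 := quadric_order w.
    by split=> [|i _]; apply: w2; rewrite ?mdeg0 ?mdeg1.
  apply/eqP; apply: contraNT wH => a0N.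
  suff : ideal2 H (mpoly_of_dhomog (a ord0 0 *: w)).
    by move=> /ideal2_quadric; rewrite rpredZeq (negPf a0N).
  have /ideal2P [h hH wh] := Ia _ I1w.
  apply/ideal2P; exists h => //.
  rewrite (_ : _ - _ =
    ((a ord0 0 *: 1 + l) * mpoly_of_dhomog w - mpoly_of_dhomog h) -
    l * mpoly_of_dhomog w).
    apply: (idealB (order_ge_ideal K n 3)) => //.
    exact: (order_geM l1 (quadric_order w)).
  by rewrite mpoly_dhomogZ mulrDl -scalerAl mul1r; ring.
have a'0 : a' = 0.
  apply/eqP; apply: contraT => /avoid [j /negP []].
  apply: ideal2_quadric.
  have I1j : ideal1 K n s 'X_(val j).
    apply/ideal1P; split=> [|i si]; first by rewrite mcoeffXU_deg ?mdeg0.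
    rewrite mcoeffXU; case: eqP => // ji; have := valP j; rewrite ji; lia.
  have := Ia _ I1j; rewrite a0 scale0r add0r mulr_suml.
  congr (ideal2 H _); rewrite (raddf_sum (@mpoly_of_dhomog n K 2)).
  by apply: eq_bigr => k _; rewrite -scalerAl.
apply/colP=> i; rewrite [RHS]mxE; case: (unliftP ord0 i) => [k ->|->//].
by have := congr1 (fun u : 'cV[K]_c => u k 0) a'0; rewrite !mxE.
Qed.

Hypotheses (s2 : (2 <= s)%N) (sn : (s <= n - 2)%N).

Lemma probe_val (k : 'I_c) :
  probe k = (if (k < 2)%N then k : nat else k - 2 + s)%N :> nat.
Proof. by rewrite inordK //; have := ltn_ord k; case: ifP; lia. Qed.

Lemma probe_inj : injective probe.
Proof.
move=> k l /(congr1 val) /=; rewrite !probe_val => kl; apply: val_inj => /=.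
by move: kl; case: ifP; case: ifP; lia.
Qed.

(** The pencil of dual quadrics whose annihilator is the special H.  On
    products l x_j with j >= s the first functional is the coefficient of x_j
    in l, and for j = n-2, n-1 the second one is the coefficient of x_0, x_1 in
    l. *)
Definition pencil (q : quadric) : 'rV[K]_2 :=
  \row_b (if b == 0
    then \sum_(j : 'I_n | (s <= j)%N) (q : {mpoly K[n]})@_(U_(j) + U_(j))
    else (q : {mpoly K[n]})@_(U_(inord 0) + U_(inord m.-1)) +
         (q : {mpoly K[n]})@_(U_(inord 1) + U_(inord m))).

Lemma pencil_is_linear : linear pencil.
Proof.
move=> a p q; apply/rowP=> b; rewrite !mxE; case: eqP => _.
  rewrite mulr_sumr -big_split; apply: eq_bigr => j _.
  by rewrite /= mcoeffD mcoeffZ.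
by rewrite /= !mcoeffD !mcoeffZ; ring.
Qed.

HB.instance Definition _ :=
  GRing.isLinear.Build K quadric 'rV[K]_2 _ pencil pencil_is_linear.

Lemma pencil_diag (i j : 'I_n) : (s <= j)%N ->
  pencil (var2 i j) 0 0 = (i == j)%:R.
Proof.
move=> sj; rewrite mxE eqxx (bigD1 j) //= big1 => [|l /andP [_ lj]].
  by rewrite mcoeff_var2 eqxx andbT orbb addr0.
by rewrite mcoeff_var2 ![j == l]eq_sym (negPf lj) !andbF.
Qed.

Lemma pencil_edge0 (i : 'I_n) :
  pencil (var2 i (inord m.-1)) 0 1 = (i == inord 0)%:R.
Proof.
rewrite mxE /= !mcoeff_var2 -![inord _ == inord _]val_eqE /= !inordK; try lia.
rewrite eqxx andbT.
have -> : (m.-1 == 0)%N = false by lia.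
have -> : (m.-1 == 1)%N = false by lia.
have -> : (m.-1 == m)%N = false by lia.
by rewrite !andbF /= orbF addr0.
Qed.

Lemma pencil_edge1 (i : 'I_n) :
  pencil (var2 i (inord m)) 0 1 = (i == inord 1)%:R.
Proof.
rewrite mxE /= !mcoeff_var2 -![inord _ == inord _]val_eqE /= !inordK; try lia.
rewrite eqxx andbT.
have -> : (m == 0)%N = false by lia.
have -> : (m == 1)%N = false by lia.
have -> : (m == m.-1)%N = false by lia.
by rewrite !andbF /= orbF add0r.
Qed.

Definition special_pencil_kernel : {vspace quadric} := lker (linfun pencil).

Lemma mem_special (q : quadric) :
  (q \in special_pencil_kernel) = (pencil q == 0).
Proof. by rewrite memv_ker lfunE. Qed.

Lemma codim_special :
  (\dim special_pencil_kernel + 2 = \dim {:quadric})%N.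
Proof.
rewrite -(limg_ker_dim (linfun pencil) fullv) capfv; congr (_ + _)%N.
suff -> : limg (linfun pencil) = fullv by rewrite dimvf /dim /= mul1n.
apply/vspaceP=> r; rewrite memvf; apply/memv_imgP.
(* The squares and the products are dual to the pencil for x_(n-1)^2 and
   x_0 x_(n-2). *)
exists (r 0 0 *: var2 (inord m) (inord m) +
        r 0 1 *: var2 (inord 0) (inord m.-1)).
  exact: memvf.
rewrite lfunE /= linearD !linearZ /=; apply/rowP=> b.
rewrite mxE [in RHS]mxE [X in _ + X]mxE.
have [->|->] : b = 0 \/ b = 1.
  by case: b => [[|[|//]] ?]; [left|right]; apply: val_inj.
  rewrite !pencil_diag ?inordK ?eqxx; try lia.
  rewrite -val_eqE /= !inordK; try lia.
  have -> : (0 == m.-1)%N = false by lia.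
  by rewrite mulr1 mulr0 addr0.
rewrite pencil_edge0 pencil_edge1 eqxx -val_eqE /= !inordK; try lia.
have -> : (m == 1)%N = false by lia.
by rewrite mulr1 mulr0 add0r.
Qed.

(** For each k some functional of the pencil and some x_j send the combination
    of the x_(probe i) with coefficients a i to a k. *)
Lemma special_avoids (a : 'cV[K]_c) : a != 0 ->
  exists j, \sum_i a i 0 *: product_form i j \notin special_pencil_kernel.
Proof.
move=> /cV0Pn [k ak].
have pencilE b (j : tail) :
    pencil (\sum_i a i 0 *: product_form i j) 0 b =
    \sum_i a i 0 * pencil (var2 (probe i) (val j)) 0 b.
  by rewrite linear_sum summxE; apply: eq_bigr => i _; rewrite linearZ mxE.
have pick (j : tail) b :
    (forall i, pencil (var2 (probe i) (val j)) 0 b = (i == k)%:R) ->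
    \sum_i a i 0 *: product_form i j \notin special_pencil_kernel.
  move=> jk; rewrite mem_special; apply: contra ak => /eqP a0.
  have := pencilE b j; rewrite a0 mxE (bigD1 k) //= jk eqxx mulr1 big1.
    by rewrite addr0 => <-.
  by move=> i ik; rewrite jk (negPf ik) mulr0.
have [k2|k2] := ltnP k 2.
  have sm : (s <= (inord m : 'I_n))%N by rewrite inordK; lia.
  have sm1 : (s <= (inord m.-1 : 'I_n))%N by rewrite inordK; lia.
  have probek : probe k = inord k.
    by apply: val_inj; rewrite /= probe_val k2 inordK //; lia.
  have [k0|k1] : k = 0%N :> nat \/ k = 1%N :> nat by lia.
    exists (exist _ (inord m.-1) sm1); apply: (pick _ 1) => i /=.
    have probe0 : probe k = inord 0 by rewrite probek k0.
    by rewrite pencil_edge0 -probe0 (inj_eq probe_inj).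
  exists (exist _ (inord m) sm); apply: (pick _ 1) => i /=.
  have probe1 : probe k = inord 1 by rewrite probek k1.
  by rewrite pencil_edge1 -probe1 (inj_eq probe_inj).
have sk : (s <= probe k)%N by rewrite probe_val; case: ifP; lia.
exists (exist _ (probe k) sk); apply: (pick _ 0) => i /=.
by rewrite pencil_diag // (inj_eq probe_inj).
Qed.

End SpecialPencil.

(** * Non-smoothability *)

(** The bound on the colon ideal holds on the closure of the reduced nestings,
    since the lengths 1 + s and c = n + 2 - s add up to n + 3, and it fails at
    the point for H in the open set of [Gr_open_avoiding]. *)
Lemma generic_not_smoothable (K : closedFieldType) (m s : nat) :
  (2 <= s <= m.+1 - 2)%N ->
  exists U : set {vspace dhomog m.+1 K 2},
    [/\ Gr_open (\dim {: dhomog m.+1 K 2} - 2)%N U, U !=set0 &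
        forall H, U H ->
          let d := [tuple (1 + s)%N; (m.+1 + 3)%N] in
          let I := [tuple ideal1 K m.+1 s; ideal2 H] in
          hilb_point d I /\ ~ smoothable d I].
Proof.
case/andP=> s2 sn; have codim := codim_special K s2 sn.
eexists; split; first exact: (Gr_open_avoiding _ (product_form K (s := s))).
  exists (special_pencil_kernel K m s); split; last exact: special_avoids.
  by rewrite -codim addnK.
move=> H [dimH avoid] d I.
have pointI : hilb_point d I.
  apply: hilb_point_ideals; first by lia.
  by move: dimH => /= ->; rewrite -codim addnK addKn.
split=> // -[_ /(_ _ (@colon_colength_closed K m.+1 (m.+1 - s + 2) d))].
have Hproper : H != fullv.
  by apply/eqP => HE; move: dimH; rewrite HE /= -codim; lia.
move=> reduced_in_component.
apply: (avoiding_not_colon_colength Hproper avoid).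
apply: reduced_in_component => I' [idealI' nestI' dimI'] radI'.
apply: (@radical_colon_colength _ _ _ _ _ _ _ (idealI' ord0) (idealI' ord_max) _
  (dimI' ord0) (dimI' ord_max)) => //; first exact: nestI'.
by rewrite /tnth /=; lia.
Qed.

(* The number of variables is n = m.+1, and the base field is R[i]. *)
Theorem theorem1 (R : realType) (m s : nat)
    (hn : (4 <= m.+1)%N) (hs : (2 <= s <= m.+1 - 2)%N) :
  exists U : set {vspace dhomog m.+1 R[i] 2},
    [/\ Gr_open (\dim {: dhomog m.+1 R[i] 2} - 2)%N U, U !=set0 &
        forall H, U H ->
          let d := [tuple (1 + s)%N; (m.+1 + 3)%N] in
          let I := [tuple ideal1 R[i] m.+1 s; ideal2 H] in
          hilb_point d I /\ ~ smoothable d I].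
Proof. exact: generic_not_smoothable hs. Qed.
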